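(* Let $u\in U$ be the exact solution of the variational problem $b(u,v)=l(v)$ for all $v\in V$, and let $u_\theta\in U_{NN}\subset U$ be a neural network approximation. Let $\phi(u_\theta)\in V$ and $\phi_k(u_\theta)\in V_k$ be the continuous and discrete Riesz representatives of the residual $r(u_\theta,\cdot)$, i.e. $(\phi(u_\theta),v)_V=r(u_\theta,v)$ for all $v\in V$ and $(\phi_k(u_\theta),v_k)_V=r(u_\theta,v_k)$ for all $v_k\in V_k$. Let $\Pi_k:V\to V_k$ be an operator for which there is a constant $C_{\Pi_k}>0$ with $\|\Pi_k v\|_V\le C_{\Pi_k}\|v\|_V$ for all $v\in V$. Let $$D_{\Pi_k}:=\|I-\Pi_k\|=\sup_{0\ne v\in V}\frac{\|v-\Pi_k v\|_V}{\|v\|_V},\qquad \mathcal{R}_k(u-u_\theta):=\sup_{0\neq v\in V}\frac{b(u-u_\theta,v-\Pi_k v)}{\|v\|_V}.$$ Then $$\|\phi(u_\theta)-\phi_k(u_\theta)\|_V+\|\phi_k(u_\theta)\|_V\le \mathcal{R}_k(u-u_\theta)+(1+D_{\Pi_k})\|\phi_k(u_\theta)\|_V$$ and $$\mathcal{R}_k(u-u_\theta)+\|\phi_k(u_\theta)\|_V\le \|\phi(u_\theta)-\phi_k(u_\theta)\|_V+(1+D_{\Pi_k})\|\phi_k(u_\theta)\|_V.$$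
   Context: Setting: $U$ and $V$ are (real) Hilbert spaces with norms $\|\cdot\|_U$, $\|\cdot\|_V$; $(\cdot,\cdot)_V$ is the inner product inducing $\|\cdot\|_V$. $b:U\times V\to\mathbb{R}$ is a bilinear form and $l\in V'$ a bounded linear functional such that: (1) there is $\mu>0$ with $b(w,v)\le\mu\|w\|_U\|v\|_V$ for all $w\in U$, $v\in V$; (2) there is $\alpha>0$ with $\sup_{0\ne v\in V}\frac{b(w,v)}{\|v\|_V}\ge\alpha\|w\|_U$ for all $w\in U$; (3) if $v\in V$ satisfies $b(w,v)=0$ for all $w\in U$, then $v=0$. Under these assumptions the problem ''find $u\in U$ with $b(u,v)=l(v)$ for all $v\in V$'' has a unique solution. For $w\in U$ the residual is $r(w,\cdot):=l(\cdot)-b(w,\cdot)\in V'$. $V_k\subset V$ is a finite-dimensional subspace. $U_{NN}=\{u_\theta:\theta\in\mathbb{R}^s\}\subset U$ is the set of functions representable by a fixed neural network architecture with parameter vector $\theta$; only $U_{NN}\subset U$ is assumed. *)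

(* Defs.v *)
From HB Require Import structures.
From mathcomp Require Import all_boot all_order all_algebra.
From mathcomp Require Import all_classical all_reals all_analysis.
Import Order.TTheory GRing.Theory Num.Theory.
Import numFieldNormedType.Exports.

Set Implicit Arguments.
Unset Strict Implicit.
Unset Printing Implicit Defensive.

Local Open Scope classical_set_scope.
Local Open Scope ring_scope.

(* On a complete normed module this makes the space a real Hilbert space:
   [{dot V for idfun}] is the library type of symmetric positive definite
   bilinear forms. *)
Definition induces_norm (R : realType) (V : normedModType R)
    (ip : {dot V for idfun}) : Prop :=
  forall v : V, ip v v = `|v| ^+ 2.

Definition finite_dim_subspace (R : realType) (V : lmodType R)
    (W : set V) : Prop :=
  exists (n : nat) (e : 'I_n -> V),
    W = [set v | exists c : 'I_n -> R, v = \sum_(i < n) c i *: e i].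

Definition bounded_functional (R : realType) (V : normedModType R)
    (l : {scalar V}) : Prop :=
  exists M : R, forall v : V, `|l v| <= M * `|v|.

(* sup_{0 <> v in V} g v / |v|.  The real-valued [sup] is [0] on the empty set,
   which is the relevant convention when V = 0, and also on sets that are not
   bounded above. *)
Definition sup_quotient (R : realType) (V : normedModType R)
    (g : V -> R) : R :=
  sup [set g v / `|v| | v in [set v : V | v != 0]].

Definition residual (R : realType) (U V : normedModType R)
    (b : {bilinear U -> V -> R | *%R & *%R}) (l : {scalar V})
    (w : U) (v : V) : R :=
  l v - b w v.

(* The operator norm of I - Pi. *)
Definition projection_defect (R : realType) (V : normedModType R)
    (Pi : V -> V) : R :=
  sup_quotient (fun v => `|v - Pi v|).

Definition oscillation (R : realType) (U V : normedModType R)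
    (b : {bilinear U -> V -> R | *%R & *%R}) (Pi : V -> V) (w : U) : R :=
  sup_quotient (fun v => b w (v - Pi v)).

(* Main.v *)
(* With e = u - u_theta, the two Riesz identities give, since Pi maps into Vk,
     b(e, v - Pi v) = (phi - phi_k, v) + (phi_k, v - Pi v)   for all v in V.
   The second term is at most D_Pi |phi_k| |v| in absolute value, and by
   Cauchy-Schwarz the first is at most |phi - phi_k| |v|, with equality at
   v = phi - phi_k; hence R_k(e) and |phi - phi_k| differ by at most
   D_Pi |phi_k|. *)

Require Import Defs.
From mathcomp Require Import all_boot all_order all_algebra.
From mathcomp Require Import all_classical all_reals all_analysis.
From mathcomp Require Import lra.
Import Order.TTheory GRing.Theory Num.Theory.
Import numFieldNormedType.Exports.

Set Implicit Arguments.
Unset Strict Implicit.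

Local Open Scope classical_set_scope.
Local Open Scope ring_scope.

(* The library's [CauchySchwarz] is restricted to finite-dimensional spaces over
   algebraically closed fields; here it is read off the triangle inequality. *)
Lemma ip_le_norm (R : realType) (V : normedModType R) (ip : {dot V for idfun})
    (ip_norm : induces_norm ip) (x y : V) : ip x y <= `|x| * `|y|.
Proof.
have : ip (x + y) (x + y) <= (`|x| + `|y|) ^+ 2.
  by rewrite ip_norm lerXn2r ?nnegrE ?addr_ge0 // ler_normD.
rewrite linearDl !linearDr /= !ip_norm.
have -> : ip y x = ip x y by rewrite hermC /= expr0 mul1r.
by rewrite sqrrD; lra.
Qed.

Lemma ip_norm_le (R : realType) (V : normedModType R) (ip : {dot V for idfun})
    (ip_norm : induces_norm ip) (x y : V) : `|ip x y| <= `|x| * `|y|.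
Proof.
rewrite ler_norml ip_le_norm // andbT lerNl -linearNl -[`|x|]normrN.
exact: ip_le_norm.
Qed.

(** The real [sup] is a true upper bound only on a set bounded above; the linear bound [g_le]
    guarantees this, whatever the size of [M]. *)
Lemma le_sup_quotient (R : realType) (V : normedModType R) (g : V -> R)
    (M : R) (g_le : forall v, g v <= M * `|v|) (v : V) :
  v != 0 -> g v <= sup_quotient g * `|v|.
Proof.
move=> v0; rewrite -ler_pdivrMr ?normr_gt0 //.
apply: ub_le_sup; last by exists v.
by exists M => _ [w w0 <-]; rewrite ler_pdivrMr ?normr_gt0.
Qed.

Lemma sup_quotient_le (R : realType) (V : normedModType R) (g : V -> R)
    (M : R) (M_ge0 : 0 <= M) (g_le : forall v, g v <= M * `|v|) :
  sup_quotient g <= M.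
Proof.
rewrite /sup_quotient; set S := [set _ | _ in _].
(* If V = 0 there are no quotients and the supremum is 0; this is where [M_ge0] enters. *)
have [->|/set0P S0] := eqVneq S set0; first by rewrite sup0.
by apply: ge_sup => // _ [w w0 <-]; rewrite ler_pdivrMr ?normr_gt0.
Qed.

Lemma sup_quotient_ge0 (R : realType) (V : normedModType R) (g : V -> R)
    (g_ge0 : forall v, v != 0 -> 0 <= g v) : 0 <= sup_quotient g.
Proof.
rewrite /sup_quotient; set S := [set _ | _ in _].
have S_ge0 r : S r -> 0 <= r by move=> [v v0 <-]; rewrite divr_ge0 ?g_ge0.
(* Without a finite supremum, [sup] takes its default value 0. *)
have [bS|/sup_out -> //] := pselect (has_sup S).
by have [[r Sr] ubS] := bS; apply: le_trans (S_ge0 r Sr) (ub_le_sup ubS Sr).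
Qed.

Section RieszGap.
Context (R : realType) (V : normedModType R) (ip : {dot V for idfun}).
Context (ip_norm : induces_norm ip) (x y : V) (P : V -> V) (C : R).
Context (P_bounded : forall v, `|P v| <= C * `|v|).

(** For [x = phi - phi_k], [y = phi_k] and [P = Pi] this is b(u - u_theta, v - Pi v). *)
Let g (v : V) := ip x v + ip y (v - P v).

Lemma projection_defect_ge0 : 0 <= projection_defect P.
Proof. exact: sup_quotient_ge0. Qed.

Lemma norm_projection_defect (v : V) :
  `|v - P v| <= projection_defect P * `|v|.
Proof.
(* [P] is not assumed linear; that it vanishes at 0 follows from [P_bounded]. *)
have [->|v0] := eqVneq v 0.
  by rewrite sub0r normrN normr0 mulr0 (le_trans (P_bounded 0)) ?normr0 ?mulr0.
(* The constant [1 + C] comes from the triangle inequality and makes the defect a finite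
   supremum. *)
apply: (@le_sup_quotient R V (fun v => `|v - P v|) (1 + C)) => // w.
by rewrite mulrDl mul1r (le_trans (ler_normB _ _)) // lerD2l.
Qed.

Lemma ip_defect_le (v : V) :
  `|ip y (v - P v)| <= projection_defect P * `|y| * `|v|.
Proof.
apply: le_trans (ip_norm_le ip_norm _ _) _.
by rewrite mulrAC mulrC ler_wpM2r // norm_projection_defect.
Qed.

Lemma gap_functional_le (v : V) :
  g v <= (`|x| + projection_defect P * `|y|) * `|v|.
Proof.
rewrite mulrDl lerD // ?ip_le_norm //.
exact: le_trans (ler_norm _) (ip_defect_le v).
Qed.

Lemma sup_gap_le : sup_quotient g <= `|x| + projection_defect P * `|y|.
Proof.
apply: sup_quotient_le gap_functional_le.
by rewrite addr_ge0 // mulr_ge0 // projection_defect_ge0.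
Qed.

Lemma sup_gap_ge : `|x| <= sup_quotient g + projection_defect P * `|y|.
Proof.
(* One nonzero vector attaining equality in Cauchy-Schwarz against [x] suffices: [ip x v] is [g v]
   up to the defect term, and the factor |v| cancels. *)
have test (v : V) : v != 0 -> `|x| * `|v| <= ip x v ->
    `|x| <= sup_quotient g + projection_defect P * `|y|.
  move=> v0 xv; have vgt0 : 0 < `|v| by rewrite normr_gt0.
  rewrite -(ler_pM2r vgt0) mulrDl.
  have := le_sup_quotient gap_functional_le v0; rewrite /g.
  have := ip_defect_le v; rewrite ler_norml => /andP[+ _].
  by move: xv; lra.
(* The extremal v = x is unavailable when x = 0; any nonzero v then works. *)
have [x0|x0] := eqVneq x 0; last by apply: (test x); rewrite // ip_norm expr2.
have [[v v0]|V0] := pselect (exists v : V, v != 0).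
  by apply: (test v); rewrite // x0 normr0 mul0r linear0l.
(* Here V = 0, so the sign condition on [g] is vacuous. *)
rewrite x0 normr0 addr_ge0 ?mulr_ge0 ?projection_defect_ge0 //.
by apply: sup_quotient_ge0 => v v0; case: V0; exists v.
Qed.

End RieszGap.

Unset Implicit Arguments.
Set Strict Implicit.

Theorem proposition4p2 (R : realType) (U V : completeNormedModType R)
    (ipU : {dot U for idfun}) (ipV : {dot V for idfun})
    (ipU_norm : induces_norm ipU) (ipV_norm : induces_norm ipV)
    (b : {bilinear U -> V -> R | *%R & *%R}) (l : {scalar V})
    (l_bounded : bounded_functional l)
    (mu : R) (mu_gt0 : 0 < mu)
    (b_bounded : forall (w : U) (v : V), b w v <= mu * `|w| * `|v|)
    (alpha : R) (alpha_gt0 : 0 < alpha)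
    (b_infsup : forall w : U, alpha * `|w| <= sup_quotient (b w))
    (b_nondeg : forall v : V, (forall w : U, b w v = 0) -> v = 0)
    (Vk : set V) (Vk_findim : finite_dim_subspace Vk)
    (s : nat) (u_NN : 'rV[R]_s -> U) (theta : 'rV[R]_s)
    (u : U) (u_sol : forall v : V, b u v = l v)
    (phi : V)
    (phi_riesz : forall v : V, ipV phi v = residual b l (u_NN theta) v)
    (phi_k : V) (phi_k_Vk : Vk phi_k)
    (phi_k_riesz : forall v : V, Vk v ->
       ipV phi_k v = residual b l (u_NN theta) v)
    (Pi : V -> V) (Pi_Vk : forall v : V, Vk (Pi v))
    (C : R) (C_gt0 : 0 < C) (Pi_bounded : forall v : V, `|Pi v| <= C * `|v|) :
  `|phi - phi_k| + `|phi_k|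
    <= oscillation b Pi (u - u_NN theta)
       + (1 + projection_defect Pi) * `|phi_k|
  /\
  oscillation b Pi (u - u_NN theta) + `|phi_k|
    <= `|phi - phi_k| + (1 + projection_defect Pi) * `|phi_k|.
Proof.
have gapE : oscillation b Pi (u - u_NN theta) =
    sup_quotient (fun v => ipV (phi - phi_k) v + ipV phi_k (v - Pi v)).
  rewrite /oscillation; congr sup_quotient; apply/funext => v.
  (* The terms [ipV phi_k v] cancel, so the discrete identity is used only at [Pi v], which lies in
     [Vk]. *)
  rewrite linearBl linearBl !linearBr /= (phi_k_riesz _ (Pi_Vk v)) phi_riesz.
  by rewrite /residual -!u_sol; lra.
have ge := sup_gap_ge ipV_norm (phi - phi_k) phi_k Pi_bounded.
have le := sup_gap_le ipV_norm (phi - phi_k) phi_k Pi_bounded.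
by rewrite gapE mulrDl mul1r; split; lra.
Qed.
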